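(* Let $\overline{\omega}$ and $\overline{\omega'}$ be two value transcendental extensions of $\overline{\nu}$ to $\overline{K}(x)$. Then the following are equivalent: (i) $\overline{\omega}|_{K(x)}=\overline{\omega'}|_{K(x)}$; (ii) there exist minimal pairs of definition $(a,\gamma)$ and $(a',\gamma')$ for $\overline{\omega}$ and $\overline{\omega'}$ respectively such that $a$ and $a'$ are conjugates over $K$. In this case $\gamma=\gamma'$. Further, for any polynomial $g(x)\in K[x]$ with $\deg g<[K(a):K]$, we have $\overline{\nu}g(a)=\overline{\nu}g(a')$.
   Context: $(K,\nu)$ is a valued field (values written additively, $\nu 0=\infty$), $\overline{K}$ a fixed algebraic closure of $K$, $\overline{\nu}$ a fixed extension of $\nu$ to $\overline{K}$, and $K(x)\subseteq\overline{K}(x)$ are rational function fields. An extension $\overline{\omega}$ of $\overline{\nu}$ to $\overline{K}(x)$ is value transcendental if $\dim_{\mathbb{Q}}\big((\overline{\omega}\,\overline{K}(x)/\overline{\nu}\,\overline{K})\otimes_{\mathbb{Z}}\mathbb{Q}\big)=1$, where $\overline{\nu}\,\overline{K}$, $\overline{\omega}\,\overline{K}(x)$ are the value groups. For $a\in\overline{K}$ and $\gamma$ in an ordered abelian group containing $\overline{\nu}\,\overline{K}$, $\overline{\nu}_{a,\gamma}$ is the valuation on $\overline{K}(x)$ determined by $\overline{\nu}_{a,\gamma}\big(\sum_i c_i(x-a)^i\big)=\min_i\{\overline{\nu}c_i+i\gamma\}$ ($c_i\in\overline{K}$). A pair $(a,\gamma)$ with $a\in\overline{K}$, $\gamma\in\overline{\omega}\,\overline{K}(x)$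 is a pair of definition for $\overline{\omega}$ if $\overline{\omega}=\overline{\nu}_{a,\gamma}$; it is a minimal pair of definition (over $K$) if moreover for every $b\in\overline{K}$, $\overline{\nu}(a-b)\geq\gamma$ implies $[K(a):K]\leq[K(b):K]$. When $\overline{\omega}|_{K(x)}=\overline{\omega'}|_{K(x)}=:\omega$, the value groups of $\overline{\omega}$ and $\overline{\omega'}$ are both regarded as subgroups of the divisible hull of $\omega K(x)$, so that $\gamma$ and $\gamma'$ can be compared.
   Formalization: Condition (ii) is taken together with γ=γ' and ν̄g(a)=ν̄g(a') for all g in K[x] with deg g<[K(a):K]; without them (ii)⇒(i) fails (e.g. ν trivial, a=a'=0, γ=1, γ'=−1). Given (i), both are proved for all conjugate minimal pairs. *)

(* Defs.v *)
From HB Require Import structures.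
From mathcomp Require Import all_boot all_order all_algebra.
From mathcomp.classical Require Import boolp classical_sets.

Set Implicit Arguments.
Unset Strict Implicit.
Unset Printing Implicit Defensive.

Import Order.TTheory GRing.Theory.
Local Open Scope ring_scope.

(* MathComp's porderZmodType imposes no compatibility between order and       *)
(* addition, hence this (additively written, totally) ordered abelian group.  *)
HB.mixin Record isOrderedAbGroup G of Num.POrderedZmodule G := {
  oag_le_total : forall x y : G, (x <= y) || (y <= x);
  oag_leD2l : forall z x y : G, x <= y -> z + x <= z + y
}.

#[short(type="orderedAbGroupType")]
HB.structure Definition OrderedAbGroup :=
  { G of isOrderedAbGroup G & Num.POrderedZmodule G }.

(* G together with oo is encoded as option G, with None for oo.               *)
Section WithInfinity.
Variable G : orderedAbGroupType.
Implicit Types x y : option G.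

Definition oadd x y : option G :=
  if (x, y) is (Some a, Some b) then Some (a + b) else None.

Definition ole x y : bool :=
  match x, y with
  | _, None => true
  | None, Some _ => false
  | Some a, Some b => a <= b
  end.

Definition omin x y : option G := if ole x y then x else y.

End WithInfinity.

Record valuation (F : fieldType) (G : orderedAbGroupType) := Valuation {
  valuation_fun :> F -> option G;
  valuation_infty : forall x, valuation_fun x = None <-> x = 0;
  valuationM : forall x y,
    valuation_fun (x * y) = oadd (valuation_fun x) (valuation_fun y);
  valuationD : forall x y,
    ole (omin (valuation_fun x) (valuation_fun y)) (valuation_fun (x + y))
}.

Definition value_group (F : fieldType) (G : orderedAbGroupType)
    (v : valuation F G) (g : G) : Prop :=
  exists x : F, v x = Some g.

Definition extends (F E : fieldType) (G : orderedAbGroupType) (i : F -> E)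
    (w : valuation E G) (v : valuation F G) : Prop :=
  forall x, w (i x) = v x.

(* For subgroups H <= A of G, dim_Q ((A / H) (x)_Z Q) = n. The tensor product  *)
(* is given by its universal property (extension of scalars from Z to Q): V   *)
(* with phi : A -> V is universal among the Q-vector spaces W equipped with   *)
(* an additive map psi : A -> W vanishing on H. Since A is a predicate, phi   *)
(* and psi are functions on G whose values outside of A are irrelevant.       *)
Section QuotientTensorQ.
Variables (G : zmodType) (A H : G -> Prop).

Definition additive_mod (W : zmodType) (psi : G -> W) : Prop :=
  (forall g h, A g -> A h -> psi (g + h) = psi g + psi h) /\
  (forall h, H h -> psi h = 0).

Definition is_tensorQ (V : lmodType rat) (phi : G -> V) : Prop :=
  additive_mod phi /\
  forall (W : lmodType rat) (psi : G -> W), additive_mod psi ->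
    exists L : {linear V -> W},
      (forall g, A g -> psi g = L (phi g)) /\
      (forall L' : {linear V -> W},
         (forall g, A g -> psi g = L' (phi g)) -> L' =1 L).

Definition dim_tensorQ (n : nat) : Prop :=
  exists (V : vectType rat) (phi : G -> V),
    is_tensorQ phi /\ \dim {: V} = n.

End QuotientTensorQ.

Section FieldAdjunction.
Variables (K Kbar : fieldType) (iota : {rmorphism K -> Kbar}).

Definition in_adjoin (a z : Kbar) : Prop :=
  exists p q : {poly K}, (map_poly iota q).[a] != 0 /\
    z = (map_poly iota p).[a] / (map_poly iota q).[a].

Definition is_adjoin_degree (a : Kbar) (n : nat) : Prop :=
  exists e : 'I_n -> Kbar,
    [/\ forall i, in_adjoin a (e i),
        forall z, in_adjoin a z ->
          exists c : 'I_n -> K, z = \sum_(i < n) iota (c i) * e i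
      & forall c : 'I_n -> K,
          \sum_(i < n) iota (c i) * e i = 0 -> forall i, c i = 0].

(* [K(a) : K]; the default value 0 is only taken when a is transcendental.    *)
Definition adjoin_degree (a : Kbar) : nat := xget 0%N (is_adjoin_degree a).

Definition conjugates (a b : Kbar) : Prop :=
  exists p : {poly K}, [/\ p \is monic, irreducible_poly p,
    root (map_poly iota p) a & root (map_poly iota p) b].

(* K(x) as a subfield of Kbar(x).                                             *)
Definition in_Kx (f : {fraction {poly Kbar}}) : Prop :=
  exists p q : {poly K}, q != 0 /\
    f = FracField.tofrac (map_poly iota p) / FracField.tofrac (map_poly iota q).

End FieldAdjunction.

Section PairsOfDefinition.
Variables (G : orderedAbGroupType) (K Kbar : fieldType).
Variable iota : {rmorphism K -> Kbar}.
Variable nubar : valuation Kbar G.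
Implicit Types omega : valuation {fraction {poly Kbar}} G.

Definition extends_to_Kbarx omega : Prop :=
  extends (fun c : Kbar => FracField.tofrac c%:P) omega nubar.

Definition value_transcendental omega : Prop :=
  extends_to_Kbarx omega /\
  dim_tensorQ (value_group omega) (value_group nubar) 1.

(* omega = nubar_(a, gamma): a valuation on Kbar(x) is determined by its      *)
(* values on the polynomials \sum_i c_i (x - a)^i, where c_i = c`_i.          *)
Definition is_nubar_a_gamma (a : Kbar) (gamma : G) omega : Prop :=
  forall c : {poly Kbar},
    omega (FracField.tofrac (\sum_(i < size c) c`_i *: ('X - a%:P) ^+ i)) =
    \big[@omin G/None]_(i < size c) oadd (nubar c`_i) (Some (gamma *+ i)).

Definition pair_of_definition omega (a : Kbar) (gamma : G) : Prop :=
  value_group omega gamma /\ is_nubar_a_gamma a gamma omega.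

Definition minimal_pair_of_definition omega (a : Kbar) (gamma : G) : Prop :=
  pair_of_definition omega a gamma /\
  forall b : Kbar, ole (Some gamma) (nubar (a - b)) ->
    (adjoin_degree iota a <= adjoin_degree iota b)%N.

Definition same_restriction_to_Kx omega omega' : Prop :=
  forall f, in_Kx iota f -> omega f = omega' f.

(* nubar (g(a)) = nubar (g(a')) for all g in K[x] with deg g < [K(a) : K];    *)
(* recall that size g = deg g + 1 for nonzero g. As nu need not be henselian,  *)
(* this is not automatic for conjugate a and a': take nu 5-adic on Q, g =     *)
(* X - 2 and a, a' the square roots of -1.                                    *)
Definition same_small_values (a a' : Kbar) : Prop :=
  forall g : {poly K}, (size g <= adjoin_degree iota a)%N ->
    nubar (map_poly iota g).[a] = nubar (map_poly iota g).[a'].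

End PairsOfDefinition.

(* Main.v *)
(* Value transcendence yields a in Kbar with gamma := omega(x - a) non-torsion *)
(* modulo nubar Kbar. The terms of an expansion in powers of x - a then have  *)
(* pairwise different values, so omega = nubar_(a, gamma), and omega(x - b) = *)
(* min(gamma, nubar(a - b)); a minimal pair is one with [K(a) : K] minimal.   *)
(* If g in K[x] has degree < [K(a) : K], minimality gives omega(x - b) =      *)
(* nubar(a - b) for all roots b of g, whence omega g = nubar g(a).            *)
(* Let p be the minimal polynomial of a over K. Its Taylor coefficients of    *)
(* positive order are evaluations of polynomials of degree < [K(a) : K], so   *)
(* omega p = min_(i > 0) (nubar p_i(a) + i gamma) depends only on gamma and   *)
(* on small values, is strictly increasing in gamma, and is non-torsion. Thus *)
(* small values and gamma determine omega on K[x] through expansions in       *)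
(* powers of p. Conversely, if omega' agrees with omega on K(x), then         *)
(* omega' p is non-torsion, so some root c of p has omega'(x - c) non-torsion,*)
(* and (c, gamma') is a pair of definition for omega'; by symmetry its degree *)
(* is minimal, and omega p = omega' p forces gamma = gamma'.                  *)

Require Import Defs.
From HB Require Import structures.
From mathcomp Require Import all_boot all_order all_algebra.
From mathcomp Require Import zify.
From mathcomp.classical Require Import boolp classical_sets.

Set Implicit Arguments.
Unset Strict Implicit.
Unset Printing Implicit Defensive.

Import Order.TTheory GRing.Theory.
Local Open Scope ring_scope.

(** Call a value torsion if some positive multiple of it lies in the value group of [nubar]. Value
    transcendence provides a linear polynomial x - a whose value [gamma] is non-torsion
    ([value_transcendental_nontorsion]). This has two effects. The terms of an expansion in powers
    of x - a have pairwise distinct finite values, so [omega] is their minimum ([omega_expansion]).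
    And since [Kbar] is algebraically closed, a non-torsion value of a polynomial must come from one
    of its roots ([nontorsion_factor]).

    Let p be the minimal polynomial over K of the first component a of a minimal pair. If the
    restrictions agree, [omega'] takes on p the non-torsion value of [omega], so some conjugate c of
    a carries a pair for [omega'] ([conjugate_pair]); the same argument with the roles exchanged
    compares degrees and makes that pair minimal. Below degree [K(a) : K] a minimal pair computes
    [omega] by evaluation at a ([minimal_pair_horner]), which gives the equality of small values.
    The value of p is strictly increasing in [gamma] ([omega_root_lt]), which gives
    [gamma = gamma'].

    Conversely, a common [gamma] and common small values fix the value of p, then the value of every
    element of K[x] through its expansion in powers of p ([same_omega]), and finally the value of
    every quotient. *)

(** * Ordered abelian groups and minima with infinity *)

Section OrderWithInfinity.
Variable G : orderedAbGroupType.
Implicit Types (g h : G) (x y z : option G).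

Lemma oag_ltD2l (z x y : G) : x < y -> z + x < z + y.
Proof.
rewrite !lt_def => /andP[nxy lexy].
by rewrite (inj_eq (addrI z)) nxy oag_leD2l.
Qed.

Lemma oag_ltD2r (z x y : G) : x < y -> x + z < y + z.
Proof. by rewrite ![_ + z]addrC; apply: oag_ltD2l. Qed.

Lemma oag_ltMn2r g h n : g < h -> g *+ n.+1 < h *+ n.+1.
Proof.
move=> ltgh; elim: n => [|n IHn]; first by rewrite !mulr1n.
rewrite [g *+ _]mulrS [h *+ _]mulrS.
exact: lt_trans (oag_ltD2l _ IHn) (oag_ltD2r _ ltgh).
Qed.

Lemma oag_leNgt g h : (g <= h) = ~~ (h < g).
Proof.
apply/idP/idP => [legh|]; first by apply/negP => /lt_geF; rewrite legh.
by move: (oag_le_total g h); rewrite lt_def; case: eqVneq => [->|_] /=;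
   rewrite ?lexx // => /orP[] // ->.
Qed.

Lemma oag_mulrn_eq0 g n : (g *+ n.+1 == 0) = (g == 0).
Proof.
apply/eqP/eqP => [gn0|->]; last by rewrite mul0rn.
have [ltg|] := boolP (g < 0).
  by have := oag_ltMn2r n ltg; rewrite gn0 mul0rn ltxx.
rewrite -oag_leNgt le_eqVlt => /orP[/eqP <- //|ltg].
by have := oag_ltMn2r n ltg; rewrite gn0 mul0rn ltxx.
Qed.

Lemma ole_refl x : ole x x.
Proof. by case: x => /=. Qed.

Lemma ole_total x y : ole x y || ole y x.
Proof. by case: x y => [g|] [h|] //=; apply: oag_le_total. Qed.

Lemma ole_anti x y : ole x y -> ole y x -> x = y.
Proof.
by case: x y => [g|] [h|] //= gh hg; congr Some; apply/le_anti/andP.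
Qed.

Lemma ole_trans y x z : ole x y -> ole y z -> ole x z.
Proof. by case: x y z => [g|] [h|] [k|] //=; apply: le_trans. Qed.

Lemma ole_omin z x y : ole z (omin x y) = ole z x && ole z y.
Proof.
rewrite /omin; have [xy|nxy] := boolP (ole x y); apply/idP/andP => [h|[]//].
  by split=> //; apply: ole_trans xy.
have yx : ole y x by move: (ole_total x y); rewrite (negPf nxy).
by split=> //; apply: ole_trans yx.
Qed.

Lemma ole_bigmin (I : eqType) (s : seq I) (F : I -> option G) z :
  ole z (\big[@omin G/None]_(i <- s) F i) <-> {in s, forall i, ole z (F i)}.
Proof.
elim: s => [|i s IHs]; first by rewrite big_nil; split=> // _; case: z.
rewrite big_cons ole_omin; split=> [/andP[zi /IHs zs] j|zs].
  by rewrite inE => /predU1P[->|/zs].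
by rewrite zs ?mem_head //=; apply/IHs => j js; rewrite zs // inE js orbT.
Qed.

Lemma bigmin_mem (I : eqType) (s : seq I) (F : I -> option G) :
  \big[@omin G/None]_(i <- s) F i = None \/
  exists2 i, i \in s & \big[@omin G/None]_(i <- s) F i = F i.
Proof.
elim: s => [|i s IHs]; first by left; rewrite big_nil.
rewrite big_cons /omin; case: ifP => _; first by right; exists i; rewrite ?mem_head.
by case: IHs => [->|[j js ->]]; [left|right; exists j; rewrite // inE js orbT].
Qed.

End OrderWithInfinity.

(** For a subgroup H this is the vanishing of the class of g in (G / H) tensored with Q; the
    successor excludes the trivial multiple 0. *)
Definition torsion_mod (G : zmodType) (H : G -> Prop) (g : G) : Prop :=
  exists n : nat, H (g *+ n.+1).

(** * Valuations, and torsion modulo a value group *)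

Section Valuation.
Variables (F : fieldType) (G : orderedAbGroupType) (v : valuation F G).

Lemma val0 : v 0 = None.
Proof. exact/valuation_infty. Qed.

Lemma val_neq0 x : x != 0 -> exists g, v x = Some g.
Proof.
by case vx: (v x) => [g|]; [exists g | move/valuation_infty: vx => ->; rewrite eqxx].
Qed.

Lemma val_neq0P x g : v x = Some g -> x != 0.
Proof. by move=> vx; apply: contraPneq vx => ->; rewrite val0. Qed.

Lemma val1 : v 1 = Some 0.
Proof.
have [g v1] := val_neq0 (oner_neq0 F).
move: (valuationM v 1 1); rewrite mulr1 v1 /= => -[/eqP].
by rewrite -subr_eq0 opprD addNKr oppr_eq0 => /eqP ->.
Qed.

Lemma valN1 : v (-1) = Some 0.
Proof.
have [|g vN] := @val_neq0 (-1); first by rewrite oppr_eq0 oner_neq0.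
move: (valuationM v (-1) (-1)); rewrite mulrNN mulr1 val1 vN /= => -[/esym/eqP].
by rewrite -mulr2n oag_mulrn_eq0 => /eqP ->.
Qed.

Lemma valN x : v (- x) = v x.
Proof.
rewrite -mulN1r valuationM valN1; case: (v x) => //= g.
by rewrite /oadd /= add0r.
Qed.

Lemma valV x g : v x = Some g -> v x^-1 = Some (- g).
Proof.
move=> vx; have x0 := val_neq0P vx.
have [h vV] : exists h, v x^-1 = Some h by apply: val_neq0; rewrite invr_eq0.
move: (valuationM v x x^-1); rewrite divff // val1 vx vV /= => -[/esym/eqP].
by rewrite addrC addr_eq0 => /eqP ->.
Qed.

Lemma valX x g n : v x = Some g -> v (x ^+ n) = Some (g *+ n).
Proof.
move=> vx; elim: n => [|n IHn]; first by rewrite expr0 val1 mulr0n.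
by rewrite exprS valuationM vx IHn mulrS.
Qed.

(** The ultrametric inequality is an equality when the values differ; the hypothesis also admits two
    infinite values, that is, x = y = 0. *)
Lemma valD_distinct x y :
  (v x = v y -> v x = None) -> v (x + y) = omin (v x) (v y).
Proof.
wlog lexy : x y / ole (v x) (v y) => [hw|] dxy.
  have /orP[lexy|leyx] := ole_total (v x) (v y); first exact: hw.
  rewrite addrC hw // => [|/[dup] vyx -> ]; last by rewrite dxy.
  rewrite /omin leyx; case: ifP => // lexy; exact: ole_anti.
have -> : omin (v x) (v y) = v x by rewrite /omin lexy.
case vx: (v x) => [g|].
  apply: ole_anti; last first.
    by rewrite -vx; apply: ole_trans (valuationD v x y); rewrite ole_omin ole_refl.
  (* Here x is written as (x + y) - y: were the minimum attained at y, then x and y would have the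
     same value. *)
  move: (valuationD v (x + y) (- y)); rewrite addrK valN.
  rewrite /omin; case: ifP => [_|_ leyx]; first by rewrite vx.
  by have := dxy (ole_anti lexy leyx); rewrite vx.
move: lexy; rewrite vx; case vy: (v y) => // _.
by move/valuation_infty: vx => ->; move/valuation_infty: vy => ->; rewrite addr0 val0.
Qed.

Lemma val_sum_distinct (I : eqType) (s : seq I) (f : I -> F) :
  uniq s ->
  {in s &, forall i j, v (f i) = v (f j) -> v (f i) != None -> i = j} ->
  v (\sum_(i <- s) f i) = \big[@omin G/None]_(i <- s) v (f i).
Proof.
elim: s => [|i s IHs] /=; first by rewrite !big_nil val0.
move=> /andP[nis us] fs; rewrite !big_cons valD_distinct IHs //.
- by move=> j k js ks; apply: fs; rewrite inE ?js ?ks orbT.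
- case: (bigmin_mem s (fun i => v (f i))) => [->//|[j js ->] vij].
  apply/eqP/negPn/negP => vi; case/negP: nis.
  by rewrite (fs i j _ _ vij vi) // inE ?eqxx // js orbT.
- by move=> j k js ks; apply: fs; rewrite inE ?js ?ks orbT.
Qed.

Lemma value_group0 : value_group v 0.
Proof. by exists 1; apply: val1. Qed.

Lemma value_groupD g h : value_group v g -> value_group v h -> value_group v (g + h).
Proof. by move=> [x vx] [y vy]; exists (x * y); rewrite valuationM vx vy. Qed.

Lemma value_groupN g : value_group v g -> value_group v (- g).
Proof. by move=> [x vx]; exists x^-1; apply: valV. Qed.

Lemma value_groupMn g n : value_group v g -> value_group v (g *+ n).
Proof. by move=> [x vx]; exists (x ^+ n); apply: valX. Qed.

Local Notation torsion := (torsion_mod (value_group v)).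

Lemma torsion_value_group g : value_group v g -> torsion g.
Proof. by exists 0%N; rewrite mulr1n. Qed.

Lemma torsion_modD g h : torsion g -> torsion h -> torsion (g + h).
Proof.
move=> [m gm] [n hn]; exists (m * n + m + n)%N.
have -> : (m * n + m + n).+1 = (m.+1 * n.+1)%N by rewrite mulSn mulnS; lia.
rewrite mulrnDl mulrnA [in h *+ _]mulnC [h *+ _]mulrnA.
by apply: value_groupD; apply: value_groupMn.
Qed.

Lemma torsion_modN g : torsion g -> torsion (- g).
Proof. by move=> [m gm]; exists m; rewrite mulNrn; apply: value_groupN. Qed.

Lemma nontorsion_translate g h n :
  ~ torsion g -> value_group v h -> ~ torsion (h + g *+ n.+1).
Proof.
move=> ng vh tg; apply: ng.
have [m] : torsion (g *+ n.+1).
  rewrite -(addKr h (g *+ n.+1)); apply: torsion_modD => //.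
  exact/torsion_modN/torsion_value_group.
rewrite -mulrnA; exists (n.+1 * m.+1).-1.
by rewrite prednK // muln_gt0.
Qed.

(** An equality with m < n would make k - h + (n - m) g zero, hence torsion. This is what separates
    the terms of an expansion. *)
Lemma nontorsion_exponent_inj g h k m n :
  ~ torsion g -> value_group v h -> value_group v k ->
  h + g *+ m = k + g *+ n -> m = n.
Proof.
move=> ng; wlog lemn : h k m n / (m <= n)%N => [hw vh vk e|vh vk e].
  have [lemn|/ltnW lenm] := leqP m n; first exact: (hw h k).
  by apply/esym; apply: (hw k h).
apply/eqP; rewrite eqn_leq lemn leqNgt /=; apply/negP => ltmn.
apply: (@nontorsion_translate g (k - h) (n - m).-1 ng).
  by apply/value_groupD/value_groupN.
apply: torsion_value_group; rewrite prednK ?subn_gt0 //.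
rewrite mulrnBr // addrACA -e -opprD subrr; exact: value_group0.
Qed.

End Valuation.

(** * The degree [K(a) : K] and minimal polynomials *)

Section AdjoinDegree.
Variables (K Kbar : fieldType) (iota : {rmorphism K -> Kbar}).
Implicit Types (p q : {poly K}) (a b : Kbar).
Local Notation "p ^i" := (map_poly iota p) (at level 2, format "p ^i").

(** Invariance of dimension: freeness of [e] forces the transition matrices to satisfy
    [MA *m MB = 1], so [MA] has at most as many rows as columns. *)
Lemma is_adjoin_degree_leq a m n :
  is_adjoin_degree iota a m -> is_adjoin_degree iota a n -> (m <= n)%N.
Proof.
move=> [e [ea espan efree]] [f [fa fspan _]].
have [A eA] := choice (fun i => fspan _ (ea i)).
have [B fB] := choice (fun j => espan _ (fa j)).
pose MA : 'M_(m, n) := \matrix_(i, j) A i j.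
pose MB : 'M_(n, m) := \matrix_(j, i) B j i.
apply: (@mulmx1_min _ _ _ MA MB); apply/matrixP => i k.
have ABe : \sum_(l < m) iota ((MA *m MB) i l) * e l = e i.
  rewrite [RHS]eA.
  under eq_bigr do rewrite !mxE rmorph_sum mulr_suml.
  rewrite exchange_big; apply: eq_bigr => j _ /=.
  rewrite [in RHS]fB mulr_sumr; apply: eq_bigr => l _.
  by rewrite !mxE rmorphM mulrA.
pose c l := (MA *m MB) i l - (1%:M : 'M_m) i l.
apply/eqP; rewrite -subr_eq0; apply/eqP; apply: (efree c).
under eq_bigr do rewrite rmorphB mulrBl.
rewrite sumrB ABe (bigD1 i) //= big1 => [|j ji]; last first.
  by rewrite mxE eq_sym (negPf ji) rmorph0 mul0r.
by rewrite mxE eqxx rmorph1 mul1r addr0 subrr.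
Qed.

Lemma irredp_root_dvd p q a :
  irreducible_poly p -> root p^i a -> root q^i a = (p %| q).
Proof.
move=> irr pa; apply/idP/idP => [qa|/dvdpP[r ->]]; last first.
  by rewrite rmorphM rootM pa orbT.
apply: contraTT qa; rewrite -(irreducible_poly_coprime q irr).
by rewrite -(coprimep_map iota) => /coprimep_root/(_ pa); rewrite /root.
Qed.

Lemma horner_in_adjoin p a : in_adjoin iota a p^i.[a].
Proof. by exists p, 1; rewrite rmorph1 hornerC oner_neq0 divr1. Qed.

(** K(a) = K[a]: a Bezout relation between p and the denominator inverts the latter at a, and
    reduction modulo p bounds the degree. *)
Lemma in_adjoin_horner p a z :
  irreducible_poly p -> root p^i a -> in_adjoin iota a z ->
  exists2 r : {poly K}, (size r < size p)%N & z = r^i.[a].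
Proof.
move=> irr pa [f [g [ga ->]]].
have p0 := irredp_neq0 irr.
have : coprimep p g.
  rewrite irreducible_poly_coprime //; apply: contra ga => pg.
  by rewrite -/(root _ _) (irredp_root_dvd _ irr pa).
move=> /Bezout_eq1_coprimepP[[u w] /= uw].
have wg : w^i.[a] * g^i.[a] = 1.
  have /(congr1 (fun r => r^i.[a])) := uw.
  rewrite rmorphD !rmorphM rmorph1 hornerD !hornerM hornerC (rootP pa).
  by rewrite mulr0 add0r.
exists ((f * w) %% p); first by rewrite ltn_modp.
have /(congr1 (fun r => r^i.[a])) := divp_eq (f * w) p.
rewrite rmorphD !rmorphM hornerD !hornerM (rootP pa) mulr0 add0r => <-.
by apply: (mulIf ga); rewrite divfK // -mulrA wg mulr1.
Qed.

Lemma horner_map_wide n p a : (size p <= n)%N ->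
  p^i.[a] = \sum_(i < n) iota p`_i * a ^+ i.
Proof.
move=> sp; rewrite (@horner_coef_wide _ n) ?size_map_poly //.
by apply: eq_bigr => i _; rewrite coef_map.
Qed.

Lemma is_adjoin_degree_irred p a :
  irreducible_poly p -> root p^i a -> is_adjoin_degree iota a (size p).-1.
Proof.
move=> irr pa; have p0 := irredp_neq0 irr.
have sp : size p = (size p).-1.+1 by rewrite prednK // size_poly_gt0.
exists (fun i => a ^+ i); split=> [i|z /(in_adjoin_horner irr pa)[r sr ->]|c].
- by move: (horner_in_adjoin 'X^i a); rewrite map_polyXn hornerXn.
- by exists (fun i => r`_i); apply: horner_map_wide; rewrite -ltnS -sp.
(* A linear relation between the powers of a is read as a polynomial of degree less than that of p
   vanishing at a. *)
pose r := \poly_(i < (size p).-1) (if insub i is Some j then c j else 0).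
have rE (i : 'I_(size p).-1) : r`_i = c i by rewrite coef_poly ltn_ord valK.
move=> c0; suff r0 : r = 0 by move=> i; rewrite -rE r0 coef0.
have sr : (size r <= (size p).-1)%N by apply: size_poly.
apply/eqP; apply: contraTT (sr) => rn0.
have : root r^i a.
  apply/rootP; rewrite (horner_map_wide _ sr) -[RHS]c0.
  by apply: eq_bigr => i _; rewrite rE.
by rewrite (irredp_root_dvd _ irr pa) -ltnNge -sp => /(dvdp_leq rn0).
Qed.

Lemma adjoin_degree_irred p a :
  irreducible_poly p -> root p^i a -> adjoin_degree iota a = (size p).-1.
Proof.
move=> irr pa; have da := is_adjoin_degree_irred irr pa.
have da' : is_adjoin_degree iota a (adjoin_degree iota a).
  by apply: (@xgetPex _ 0%N (is_adjoin_degree iota a)); exists (size p).-1.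
by apply/eqP; rewrite eqn_leq !(@is_adjoin_degree_leq a).
Qed.

Lemma conjugates_adjoin_degree a b :
  conjugates iota a b -> adjoin_degree iota a = adjoin_degree iota b.
Proof.
by move=> [p [_ irr pa pb]]; rewrite !(@adjoin_degree_irred p).
Qed.

(** A nonzero polynomial of least size vanishing at a is irreducible, since one factor of any
    factorisation vanishes at a and so already has full size. *)
Lemma exists_min_poly a : algebraicOver iota a ->
  exists p, [/\ p \is monic, irreducible_poly p & root p^i a].
Proof.
move=> [q q0 qa].
pose P n := `[< exists p, [/\ p != 0, root p^i a & size p = n] >].
have exP : exists n, P n by exists (size q); apply/asboolP; exists q.
case: (ex_minnP exP) => n /asboolP[p [p0 pa <-]] pmin.
have min r : r != 0 -> root r^i a -> (size p <= size r)%N.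
  by move=> r0 ra; apply: pmin; apply/asboolP; exists r.
have irr : irreducible_poly p.
  split=> [|r sr /dvdpP[s ps]].
    rewrite ltn_neqAle size_poly_gt0 p0 andbT eq_sym.
    apply: contraL pa => /size_poly1P[c c0 ->].
    by rewrite map_polyC rootC fmorph_eq0.
  have [s0 r0] : s != 0 /\ r != 0.
    by move: p0; rewrite ps mulf_eq0 negb_or => /andP[].
  have sz : size p = (size s + size r).-1 by rewrite ps size_mul.
  have ss : (0 < size s)%N by rewrite size_poly_gt0.
  have srg : (0 < size r)%N by rewrite size_poly_gt0.
  move: pa; rewrite {1}ps rmorphM rootM => /orP[/(min _ s0)|/(min _ r0)] h.
    by move: sr => /eqP; lia.
  rewrite -dvdp_size_eqp ?ps ?dvdp_mull // -ps eqn_leq h andbT.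
  by rewrite dvdp_leq // ps dvdp_mull.
exists ((lead_coef p)^-1 *: p).
have l0 : (lead_coef p)^-1 != 0 by rewrite invr_eq0 lead_coef_eq0.
split.
- by rewrite monicE lead_coefZ mulVf // lead_coef_eq0.
- split=> [|r sr]; first by rewrite size_scale //; apply: irr.1.
  rewrite dvdpZr // => /(irr.2 _ sr) rp.
  by rewrite (eqp_trans rp) // eqp_sym eqp_scale.
- by rewrite map_polyZ rootZ // fmorph_eq0.
Qed.

Lemma adjoin_degree_leq a q :
  algebraicOver iota a -> q != 0 -> root q^i a ->
  (adjoin_degree iota a < size q)%N.
Proof.
move=> /exists_min_poly[p [_ irr pa]] q0 qa.
rewrite (adjoin_degree_irred irr pa) prednK ?size_poly_gt0 ?irredp_neq0 //.
by rewrite dvdp_leq // -(irredp_root_dvd _ irr pa).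
Qed.

End AdjoinDegree.

(** * Tensor products with Q, Taylor expansion, fractions *)

Lemma dim_tensorQ_gt0 (G : zmodType) (A H : G -> Prop) n :
  (forall g m, A g -> A (g *+ m)) ->
  dim_tensorQ A H n -> (0 < n)%N ->
  exists2 g, A g & ~ torsion_mod H g.
Proof.
move=> AMn [V [phi [[[phiD phiH] univ] dimV]]] n_gt0.
apply: contrapT => notor.
have phi0 g : A g -> phi g = 0.
  move=> Ag; have [m Hm] : torsion_mod H g.
    by apply: contrapT => ng; apply: notor; exists g.
  have phiMn k : phi (g *+ k.+1) = phi g *+ k.+1.
    elim: k => [|k IHk]; first by rewrite !mulr1n.
    by rewrite mulrS phiD ?IHk -?mulrS //; apply: AMn.
  move: (phiH _ Hm); rewrite phiMn -scaler_nat => /eqP.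
  by rewrite scaler_eq0 Num.Theory.pnatr_eq0 => /eqP.
(* Since [phi] vanishes on A, the identity and the zero map both factor [phi] through itself;
   uniqueness makes them equal, so V = 0. *)
have [L [_ Luniq]] := univ V phi (conj phiD phiH).
have id0 : (idfun : V -> V) =1 \0.
  move=> x; have -> : (\0 : V -> V) x = L x by apply: (Luniq \0) => g /phi0.
  by apply: (Luniq idfun).
move: n_gt0; rewrite -dimV lt0n => /negP; apply.
by rewrite dimv_eq0; apply/eqP/vspaceP => x; rewrite (_ : x = 0) ?mem0v //; apply: id0.
Qed.

(** Divided derivatives keep the formula valid in every characteristic. *)
Lemma taylor_XsubC (R : comNzRingType) (p : {poly R}) (a : R) :
  p = \sum_(i < size p) p^`N(i).[a] *: ('X - a%:P) ^+ i.
Proof.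
rewrite -{1}[p]comp_polyXr -{1}(subrK a%:P 'X) [_ - _ + _]addrC /comp_poly.
rewrite nderiv_taylor; last exact: mulrC.
rewrite size_map_polyC; apply: eq_bigr => i _.
by rewrite nderivn_map horner_map mul_polyC.
Qed.

Lemma size_nderivn_leq (R : nzSemiRingType) (p : {poly R}) n :
  (size p^`N(n) <= size p - n)%N.
Proof.
apply/leq_sizeP => i; rewrite leq_subLR => sp.
by rewrite coef_nderivn nth_default // mul0rn.
Qed.

Lemma fraction_div (R : idomainType) (f : {fraction R}) :
  exists n d : R, d != 0 /\ f = FracField.tofrac n / FracField.tofrac d.
Proof.
elim/quotW: f => x; exists (frac x).1, (frac x).2.
split; first exact: denom_ratioP.
have d0 : FracField.tofrac (frac x).2 != 0 by rewrite tofrac_eq0 denom_ratioP.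
apply: (mulIf d0); rewrite divfK //.
rewrite -[_ * _]/(FracField.mul _ _) !piE /FracField.mulf.
apply/eqmodP; rewrite /= FracField.equivfE.
by rewrite !numden_Ratio ?mulf_neq0 ?denom_ratioP ?oner_eq0 // !mulr1 mulrC.
Qed.

(** * Valuations on Kbar(x) and their values on linear polynomials *)

Section LinearFactors.
Variables (G : orderedAbGroupType) (Kbar : closedFieldType).
Variables (nubar : valuation Kbar G).
Implicit Types (omega : valuation {fraction {poly Kbar}} G) (a b c : Kbar).
Implicit Types (p : {poly Kbar}) (g gamma : G).
Local Notation torsion := (torsion_mod (value_group nubar)).
Local Notation "p %:F" := (FracField.tofrac p).
Local Notation "''X_' a" := (FracField.tofrac ('X - a%:P))
  (at level 8, a at level 2, format "''X_' a").

Lemma tofrac_neq0 p : p != 0 -> p%:F != 0.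
Proof. by rewrite tofrac_eq0. Qed.

Lemma pair_of_definition_XsubC omega a gamma c :
  pair_of_definition nubar omega a gamma ->
  omega 'X_(a - c) = omin (nubar c) (Some gamma).
Proof.
move=> [_ /(_ ('X + c%:P))]; rewrite size_XaddC !big_ord_recl !big_ord0 /=.
rewrite !coefD !coefX !coefC /= add0r !addr0 scale1r expr0 expr1 alg_polyC.
rewrite mulr1n val1 mulr0n /oadd /= add0r.
rewrite polyCB opprB addrCA => ->.
by case: (nubar c) => [h|] //=; rewrite addr0.
Qed.

Section Extension.
Variables (omega : valuation {fraction {poly Kbar}} G).
Hypothesis omega_ext : extends_to_Kbarx nubar omega.

(** If all linear factors of p had torsion values, so would p, because torsion values are closed
    under addition and contain the value of the leading coefficient. *)
Lemma nontorsion_factor p g :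
  omega p%:F = Some g -> ~ torsion g ->
  exists a gamma, [/\ root p a, omega 'X_a = Some gamma & ~ torsion gamma].
Proof.
move=> pg ng; apply: contrapT => notor; apply: ng.
have p0 : p != 0 by rewrite -tofrac_eq0; apply: val_neq0P pg.
have [r pE] := closed_field_poly_normal p.
have rtor z : z \in r -> exists2 h, omega 'X_z = Some h & torsion h.
  move=> zr; have [h Xh] : exists h, omega 'X_z = Some h.
    by apply/val_neq0/tofrac_neq0; rewrite polyXsubC_eq0.
  exists h => //; apply: contrapT => nh; apply: notor; exists z, h; split => //.
  by rewrite pE rootZ ?lead_coef_eq0 // root_prod_XsubC.
have [h prodh th] : exists2 h, omega (\prod_(z <- r) ('X - z%:P))%:F = Some h & torsion h.
  elim: r rtor {pE} => [|z r IHr] rtor.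
    exists 0; first by rewrite big_nil rmorph1 val1.
    exact/torsion_value_group/value_group0.
  have [|h rh th] := IHr; first by move=> y yr; apply: rtor; rewrite inE yr orbT.
  have [k zk tk] := rtor z (mem_head _ _).
  exists (k + h); last exact: torsion_modD.
  by rewrite big_cons rmorphM valuationM rh zk.
have [k lk] : exists k, nubar (lead_coef p) = Some k.
  by apply: val_neq0; rewrite lead_coef_eq0.
move: pg; rewrite pE -mul_polyC rmorphM valuationM prodh omega_ext lk => -[<-].
by apply: torsion_modD => //; apply: torsion_value_group; exists (lead_coef p).
Qed.

Lemma exists_nontorsion_XsubC f g :
  omega f = Some g -> ~ torsion g ->
  exists a gamma, omega 'X_a = Some gamma /\ ~ torsion gamma.
Proof.
have [n [d [d0 ->]]] := fraction_div f => fg ng.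
have [h dh] : exists h, omega d%:F = Some h by apply/val_neq0/tofrac_neq0.
have [k nk] : exists k, omega n%:F = Some k.
  by apply: val_neq0; apply: contraTneq (val_neq0P fg) => ->; rewrite mul0r eqxx.
have [tk|/(nontorsion_factor nk)[a [gamma []]]] := EM (torsion k); last by exists a, gamma.
have [th|/(nontorsion_factor dh)[a [gamma []]]] := EM (torsion h); last by exists a, gamma.
case: ng; move: fg; rewrite valuationM nk (valV dh) => -[<-].
by apply: torsion_modD => //; apply: torsion_modN.
Qed.

Lemma horner_value p a :
  (forall b, root p b -> omega 'X_b = nubar (a - b)) -> omega p%:F = nubar p.[a].
Proof.
have [->|p0] := eqVneq p 0; first by rewrite rmorph0 horner0 !val0.
have [r pE] := closed_field_poly_normal p => pX.
rewrite pE -mul_polyC hornerM hornerC rmorphM !valuationM omega_ext; congr oadd.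
have {pX} : {in r, forall b, omega 'X_b = nubar (a - b)}.
  move=> b br; apply: pX.
  by rewrite pE rootZ ?lead_coef_eq0 // root_prod_XsubC.
elim: r {pE} => [|b r IHr] rX; first by rewrite big_nil rmorph1 hornerC !val1.
rewrite big_cons hornerM hornerXsubC rmorphM !valuationM rX ?mem_head // IHr //.
by move=> c cr; apply: rX; rewrite inE cr orbT.
Qed.

Variables (a : Kbar) (gamma : G).
Hypothesis omegaX : omega 'X_a = Some gamma.
Hypothesis gamma_nt : ~ torsion gamma.

(** As [gamma] is non-torsion, nonzero terms of different exponents have different values, so the
    sum takes their minimum. *)
Lemma omega_expansion n (c : nat -> Kbar) :
  omega (\sum_(i < n) c i *: ('X - a%:P) ^+ i)%:F =
  \big[@omin G/None]_(i < n) oadd (nubar (c i)) (Some (gamma *+ i)).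
Proof.
have term i : omega (c i *: ('X - a%:P) ^+ i)%:F = oadd (nubar (c i)) (Some (gamma *+ i)).
  by rewrite -mul_polyC rmorphM rmorphXn valuationM omega_ext (valX _ omegaX).
rewrite rmorph_sum val_sum_distinct ?index_enum_uniq //.
  by apply: eq_bigr => i _; rewrite term.
move=> i j _ _; rewrite !term.
case ci: (nubar (c i)) => [h|] //; case cj: (nubar (c j)) => [k|] // [e] _.
apply/val_inj; apply: (nontorsion_exponent_inj gamma_nt _ _ e).
  by exists (c i).
by exists (c j).
Qed.

Lemma omega_taylor p :
  omega p%:F =
  \big[@omin G/None]_(i < size p) oadd (nubar p^`N(i).[a]) (Some (gamma *+ i)).
Proof. by rewrite -(omega_expansion _ (fun i => p^`N(i).[a])) -taylor_XsubC. Qed.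

Lemma nontorsion_pair_of_definition : pair_of_definition nubar omega a gamma.
Proof.
by split=> [|c]; [exists 'X_a | rewrite (omega_expansion _ (fun i => c`_i))].
Qed.

Lemma omega_XsubC b : omega 'X_b = omin (Some gamma) (nubar (a - b)).
Proof.
have -> : 'X_b = 'X_a + ((a - b)%:P)%:F.
  by rewrite -rmorphD polyCB addrA subrK.
rewrite valD_distinct omegaX omega_ext // => e; case: gamma_nt.
by apply: torsion_value_group; exists (a - b).
Qed.

Lemma nontorsion_value_unique b g :
  omega 'X_b = Some g -> ~ torsion g -> g = gamma.
Proof.
rewrite omega_XsubC /omin; case: ifP => _; first by case.
by move=> abg []; apply: torsion_value_group; exists (a - b).
Qed.

(** The constant Taylor coefficient at a root vanishes, so the minimum is attained at a positive
    power of x - a, which brings in [gamma]. *)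
Lemma omega_root p : p != 0 -> root p a ->
  exists i h, [/\ (0 < i)%N, nubar p^`N(i).[a] = Some h,
                omega p%:F = Some (h + gamma *+ i) & ~ torsion (h + gamma *+ i)].
Proof.
move=> p0 pa; have [g pg] : exists g, omega p%:F = Some g by apply/val_neq0/tofrac_neq0.
move: pg; rewrite omega_taylor => pg.
have := bigmin_mem (index_enum _) (fun i : 'I_(size p) =>
  oadd (nubar p^`N(i).[a]) (Some (gamma *+ i))).
rewrite pg => -[//|[i _]]; case pi: (nubar _) => [h|] //= [->].
have i0 : (0 < i)%N.
  by rewrite lt0n; apply: contraPneq pi => ->; rewrite nderivn0 (rootP pa) val0.
exists i, h; split=> //.
by rewrite -(prednK i0); apply: nontorsion_translate => //; exists p^`N(i).[a].
Qed.

End Extension.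

Lemma omega_root_lt omega omega' p a a' gamma gamma' :
  extends_to_Kbarx nubar omega -> extends_to_Kbarx nubar omega' ->
  omega 'X_a = Some gamma -> ~ torsion gamma ->
  omega' 'X_a' = Some gamma' -> ~ torsion gamma' ->
  p != 0 -> root p a' ->
  (forall i, (0 < i)%N -> nubar p^`N(i).[a] = nubar p^`N(i).[a']) ->
  gamma < gamma' -> ~~ ole (omega' p%:F) (omega p%:F).
Proof.
move=> ext ext' Xa nt Xa' nt' p0 pa' same lt_gamma.
have [i [h [i0 ph -> _]]] := omega_root ext' Xa' nt' p0 pa'.
have ip : (i < size p)%N.
  rewrite ltnNge; apply: contraPN ph => /nderivn_poly0 ->.
  by rewrite horner0 val0.
apply/negP => le'.
have := ole_refl (omega p%:F).
rewrite {2}(omega_taylor ext Xa nt) => /ole_bigmin/(_ (Ordinal ip)).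
rewrite mem_index_enum => /(_ isT) /=; rewrite same // ph => lei.
(* The index i attains the minimum for [omega'] and bounds the one for [omega], and i > 0 makes h +
   i [gamma] smaller than h + i [gamma']. *)
have := ole_trans le' lei; rewrite /= oag_leNgt => /negP; apply.
by apply: oag_ltD2l; rewrite -(prednK i0); apply: oag_ltMn2r.
Qed.

Lemma omega_root_inj omega omega' p a a' gamma gamma' :
  extends_to_Kbarx nubar omega -> extends_to_Kbarx nubar omega' ->
  omega 'X_a = Some gamma -> ~ torsion gamma ->
  omega' 'X_a' = Some gamma' -> ~ torsion gamma' ->
  p != 0 -> root p a -> root p a' ->
  (forall i, (0 < i)%N -> nubar p^`N(i).[a] = nubar p^`N(i).[a']) ->
  omega p%:F = omega' p%:F -> gamma = gamma'.
Proof.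
move=> ext ext' Xa nt Xa' nt' p0 pa pa' same e.
apply/le_anti; rewrite !oag_leNgt; apply/andP; split; apply/negP => lt.
  have /negP[] := omega_root_lt ext' ext Xa' nt' Xa nt p0 pa (fun i hi => esym (same i hi)) lt.
  by rewrite e ole_refl.
have /negP[] := omega_root_lt ext ext' Xa nt Xa' nt' p0 pa' same lt.
by rewrite e ole_refl.
Qed.

Lemma value_transcendental_nontorsion omega :
  value_transcendental nubar omega ->
  exists a gamma, omega 'X_a = Some gamma /\ ~ torsion gamma.
Proof.
move=> [ext dim1].
have [g [f fg] ng] : exists2 g, value_group omega g & ~ torsion g.
  by apply: (dim_tensorQ_gt0 _ dim1) => // g m; apply: value_groupMn.
exact: exists_nontorsion_XsubC fg ng.
Qed.

(** The value of x - b is the minimum of nubar(a - b) and [gamma]; for a b where it is non-torsion,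
    it must be [gamma]. *)
Lemma pair_of_definition_nontorsion omega a gamma :
  value_transcendental nubar omega -> pair_of_definition nubar omega a gamma ->
  omega 'X_a = Some gamma /\ ~ torsion gamma.
Proof.
move=> vt pd; split.
  by rewrite -{1}[a]subr0 (pair_of_definition_XsubC _ pd) val0.
have [b [g [Xb ng]]] := value_transcendental_nontorsion vt.
move: Xb; rewrite -(subKr a b) (pair_of_definition_XsubC _ pd) /omin.
case: ifP => _; last by case=> ->.
by move=> bg; case: ng; apply: torsion_value_group; exists (a - b).
Qed.

End LinearFactors.

(** * Minimal pairs of definition *)

Section MinimalPairs.
Variables (G : orderedAbGroupType) (K : fieldType) (Kbar : closedFieldType).
Variables (iota : {rmorphism K -> Kbar}).
Hypothesis Kbar_algebraic : forall z : Kbar, algebraicOver iota z.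
Variables (nubar : valuation Kbar G).
Implicit Types (omega : valuation {fraction {poly Kbar}} G) (a b : Kbar).
Implicit Types (p q : {poly K}) (g gamma : G).
Local Notation torsion := (torsion_mod (value_group nubar)).
Local Notation "p %:F" := (FracField.tofrac p).
Local Notation "''X_' a" := (FracField.tofrac ('X - a%:P))
  (at level 8, a at level 2, format "''X_' a").
Local Notation "p ^i" := (map_poly iota p) (at level 2, format "p ^i").
Local Notation deg := (adjoin_degree iota).

Lemma exists_minimal_pair omega : value_transcendental nubar omega ->
  exists a gamma, minimal_pair_of_definition iota nubar omega a gamma.
Proof.
move=> vt; have ext := vt.1.
(* The degree of a is minimised over all a for which x - a has a non-torsion value; any b with
   nubar(a - b) at least [gamma] is among the competitors. *)
pose P n := `[< exists a gamma,
  [/\ omega 'X_a = Some gamma, ~ torsion gamma & deg a = n] >].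
have exP : exists n, P n.
  have [a [gamma [Xa nt]]] := value_transcendental_nontorsion vt.
  by exists (deg a); apply/asboolP; exists a, gamma.
case: (ex_minnP exP) => n /asboolP[a [gamma [Xa nt <-]]] amin.
exists a, gamma; split=> [|b gab]; first exact: nontorsion_pair_of_definition.
apply: amin; apply/asboolP; exists b, gamma; split=> //.
by rewrite (omega_XsubC ext Xa nt) /omin gab.
Qed.

Section Pair.
Variables (omega : valuation {fraction {poly Kbar}} G) (a : Kbar) (gamma : G).
Hypothesis omega_vt : value_transcendental nubar omega.
Hypothesis min_pair : minimal_pair_of_definition iota nubar omega a gamma.

(** A root b of q has degree less than a, so minimality gives nubar(a - b) < [gamma], and x - b has
    the value of a - b. Multiplying over the roots gives q. *)
Lemma minimal_pair_horner q :
  (size q <= deg a)%N -> omega (q^i)%:F = nubar q^i.[a].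
Proof.
have [pd amin] := min_pair.
have [Xa nt] := pair_of_definition_nontorsion omega_vt pd.
have [-> _|q0 sq] := eqVneq q 0; first by rewrite !rmorph0 horner0 !val0.
apply: horner_value; first exact: omega_vt.1.
move=> b qb; rewrite (omega_XsubC omega_vt.1 Xa nt) /omin.
case: ifP => // /amin; rewrite leqNgt => /negP[].
exact: leq_trans (adjoin_degree_leq (Kbar_algebraic b) q0 qb) sq.
Qed.

Lemma minimal_pair_deg_leq b :
  pair_of_definition nubar omega b gamma -> (deg a <= deg b)%N.
Proof.
move=> pdb; have [pd amin] := min_pair; apply: amin.
have [Xa nt] := pair_of_definition_nontorsion omega_vt pd.
have [Xb _] := pair_of_definition_nontorsion omega_vt pdb.
move: Xb; rewrite (omega_XsubC omega_vt.1 Xa nt) /omin.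
by case: ifP => // nle e; rewrite -nle e ole_refl.
Qed.

Lemma minimal_pair_of_deg_leq c :
  pair_of_definition nubar omega c gamma -> (deg c <= deg a)%N ->
  minimal_pair_of_definition iota nubar omega c gamma.
Proof.
move=> pdc dc; split=> // b cb; apply: (leq_trans dc).
have [Xc nt] := pair_of_definition_nontorsion omega_vt pdc.
apply/minimal_pair_deg_leq/nontorsion_pair_of_definition => //.
  exact: omega_vt.1.
by rewrite (omega_XsubC omega_vt.1 Xc nt) /omin cb.
Qed.

End Pair.

(** A divided derivative of positive order of p has coefficients in K and degree less than
    [K(a) : K]. *)
Lemma irredp_nderivn_same p a a' :
  irreducible_poly p -> root p^i a -> same_small_values iota nubar a a' ->
  forall i, (0 < i)%N -> nubar p^i^`N(i).[a] = nubar p^i^`N(i).[a'].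
Proof.
move=> irr pa same i i0; rewrite nderivn_map; apply: same.
rewrite (adjoin_degree_irred irr pa) (leq_trans (size_nderivn_leq _ _)) //.
by rewrite -subn1 leq_sub2l.
Qed.

(** * Comparison of two extensions on K(x) *)

Section TwoExtensions.
Variables (omega omega' : valuation {fraction {poly Kbar}} G).
Hypotheses (omega_vt : value_transcendental nubar omega).
Hypotheses (omega'_vt : value_transcendental nubar omega').

Lemma same_restriction_poly q :
  same_restriction_to_Kx iota omega omega' -> omega q^i%:F = omega' q^i%:F.
Proof.
apply; exists q, 1; split; first exact: oner_neq0.
by rewrite !rmorph1 divr1.
Qed.

Lemma same_poly_restriction :
  (forall q, omega q^i%:F = omega' q^i%:F) -> same_restriction_to_Kx iota omega omega'.
Proof.
move=> same _ [p [q [q0 ->]]]; rewrite !valuationM same; congr oadd.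
have [|g qg] := @val_neq0 _ _ omega q^i%:F.
  by rewrite tofrac_eq0 map_poly_eq0.
have qg' : omega' q^i%:F = Some g by rewrite -same.
by rewrite (valV qg) (valV qg').
Qed.

Lemma same_restriction_small_values a gamma a' gamma' :
  same_restriction_to_Kx iota omega omega' ->
  minimal_pair_of_definition iota nubar omega a gamma ->
  minimal_pair_of_definition iota nubar omega' a' gamma' ->
  conjugates iota a a' ->
  gamma = gamma' /\ same_small_values iota nubar a a'.
Proof.
move=> same mp mp' cj.
have dE := conjugates_adjoin_degree cj.
have small : same_small_values iota nubar a a'.
  move=> q sq; rewrite -(minimal_pair_horner omega_vt mp) //.
  by rewrite -(minimal_pair_horner omega'_vt mp') -?dE // same_restriction_poly.
split=> //; have [p [_ irr pa pa']] := cj.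
have [Xa nt] := pair_of_definition_nontorsion omega_vt mp.1.
have [Xa' nt'] := pair_of_definition_nontorsion omega'_vt mp'.1.
have pi0 : p^i != 0 by rewrite map_poly_eq0 irredp_neq0.
apply: (omega_root_inj omega_vt.1 omega'_vt.1 Xa nt Xa' nt' pi0 pa pa').
  exact: irredp_nderivn_same.
exact: same_restriction_poly.
Qed.

Lemma conjugate_pair a gamma gamma' p :
  same_restriction_to_Kx iota omega omega' ->
  pair_of_definition nubar omega a gamma ->
  (exists b, pair_of_definition nubar omega' b gamma') ->
  irreducible_poly p -> root p^i a ->
  exists2 c, root p^i c & pair_of_definition nubar omega' c gamma'.
Proof.
move=> same pd [b pd'] irr pa.
have [Xa nt] := pair_of_definition_nontorsion omega_vt pd.
have [Xb nt'] := pair_of_definition_nontorsion omega'_vt pd'.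
have pi0 : p^i != 0 by rewrite map_poly_eq0 irredp_neq0.
have [i [h [_ _]]] := omega_root omega_vt.1 Xa nt pi0 pa.
rewrite same_restriction_poly // => pg /(nontorsion_factor omega'_vt.1 pg).
move=> [c [g [pc Xc ntc]]]; exists c => //.
rewrite -(nontorsion_value_unique omega'_vt.1 Xb nt' Xc ntc).
exact: (nontorsion_pair_of_definition omega'_vt.1).
Qed.

(* Expansion in powers of p: omega p is not torsion, whereas the coefficients
   have values in the value group of nubar. *)
Lemma same_omega a gamma a' p :
  minimal_pair_of_definition iota nubar omega a gamma ->
  minimal_pair_of_definition iota nubar omega' a' gamma ->
  irreducible_poly p -> root p^i a -> root p^i a' ->
  same_small_values iota nubar a a' ->
  forall q, omega q^i%:F = omega' q^i%:F.
Proof.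
move=> mp mp' irr pa pa' small.
have [Xa nt] := pair_of_definition_nontorsion omega_vt mp.1.
have [Xa' nt'] := pair_of_definition_nontorsion omega'_vt mp'.1.
have p0 := irredp_neq0 irr; have pi0 : p^i != 0 by rewrite map_poly_eq0.
have pE : omega p^i%:F = omega' p^i%:F.
  rewrite (omega_taylor omega_vt.1 Xa nt) (omega_taylor omega'_vt.1 Xa' nt').
  apply: eq_bigr => -[[|i] /= _] _; last by rewrite (irredp_nderivn_same irr pa small).
  by rewrite nderivn0 (rootP pa) (rootP pa').
have [i [h [_ _]]] := omega_root omega_vt.1 Xa nt pi0 pa.
set delta := (h + _) => pd nd; have pd' := pd; rewrite pE in pd'.
have dE : deg a' = deg a.
  by rewrite (adjoin_degree_irred irr pa) (adjoin_degree_irred irr pa').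
(* The induction must also carry the shape k + m [delta] of the value: it is what keeps the value of
   s p non-torsion, hence distinct from that of the remainder r. *)
suff main n q : (size q <= n)%N -> omega q^i%:F = omega' q^i%:F /\
    (q != 0 -> exists k m, value_group nubar k /\ omega q^i%:F = Some (k + delta *+ m)).
  by move=> q; have [] := main _ q (leqnn _).
elim: n q => [|n IHn] q.
  rewrite size_poly_leq0 => /eqP ->; rewrite eqxx; split=> //.
  by rewrite !rmorph0 !val0.
move=> sq; pose r := q %% p; pose s := q %/ p.
have ltr : (size r < size p)%N by rewrite ltn_modp.
have sr : (size r <= deg a)%N.
  by rewrite (adjoin_degree_irred irr pa) -ltnS prednK ?size_poly_gt0.
have rE : omega r^i%:F = nubar r^i.[a] by apply: (minimal_pair_horner omega_vt mp).
have rE' : omega' r^i%:F = nubar r^i.[a].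
  by rewrite small //; apply: (minimal_pair_horner omega'_vt mp'); rewrite dE.
have ss : (size s <= n)%N.
  have [q0|q0] := eqVneq q 0; first by rewrite /s q0 div0p size_poly0.
  rewrite size_divp // -ltnS (leq_trans _ sq) //.
  by rewrite ltn_subrL size_poly_gt0 q0 andbT; have := irr.1; lia.
have [sE sform] := IHn _ ss.
have qE : q^i%:F = s^i%:F * p^i%:F + r^i%:F.
  by rewrite -!(rmorphM, rmorphD) -divp_eq.
have [s0|s0] := eqVneq s 0.
  rewrite qE s0 !rmorph0 mul0r add0r rE rE'; split=> // q0.
  have [|k rk] := @val_neq0 _ _ nubar r^i.[a].
    (* If r(a) = 0, then p divides r, which is smaller, so r = 0 and q = 0. *)
    apply: contraNneq q0 => /eqP.
    rewrite -/(root _ _) (irredp_root_dvd _ irr pa) => pr.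
    rewrite (divp_eq q p) -/s -/r s0 mul0r add0r.
    by rewrite -(modp_small ltr) (modp_eq0P _ _ pr).
  by exists k, 0%N; rewrite mulr0n addr0; split=> //; exists r^i.[a].
have [k [m [kH sk]]] := sform s0.
have spE : omega (s^i%:F * p^i%:F) = Some (k + delta *+ m.+1).
  by rewrite valuationM sk pd mulrSr addrA.
have spE' : omega' (s^i%:F * p^i%:F) = Some (k + delta *+ m.+1).
  by rewrite valuationM -sE sk pd' mulrSr addrA.
have dist : Some (k + delta *+ m.+1) <> nubar r^i.[a].
  move=> e; apply: (nontorsion_translate nd kH (n := m)).
  by apply: torsion_value_group; exists r^i.[a].
rewrite qE !valD_distinct ?spE ?spE' ?rE ?rE' //; split=> // _.
rewrite /omin; case: ifP => [_|]; first by exists k, m.+1.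
case ra: (nubar r^i.[a]) => [l|] // _.
by exists l, 0%N; rewrite mulr0n addr0; split=> //; exists r^i.[a].
Qed.

End TwoExtensions.
End MinimalPairs.

Theorem theorem3p12
    (G : orderedAbGroupType) (K : fieldType) (Kbar : closedFieldType)
    (iota : {rmorphism K -> Kbar})
    (Kbar_algebraic : forall z : Kbar, algebraicOver iota z)
    (nu : valuation K G) (nubar : valuation Kbar G)
    (nubar_extends : extends iota nubar nu)
    (omega omega' : valuation {fraction {poly Kbar}} G)
    (omega_vt : value_transcendental nubar omega)
    (omega'_vt : value_transcendental nubar omega') :
  (same_restriction_to_Kx iota omega omega' <->
   exists (a : Kbar) (gamma : G) (a' : Kbar) (gamma' : G),
     [/\ minimal_pair_of_definition iota nubar omega a gamma,
         minimal_pair_of_definition iota nubar omega' a' gamma',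
         conjugates iota a a',
         gamma = gamma'
       & same_small_values iota nubar a a'])
  /\
  (same_restriction_to_Kx iota omega omega' ->
   forall (a : Kbar) (gamma : G) (a' : Kbar) (gamma' : G),
     minimal_pair_of_definition iota nubar omega a gamma ->
     minimal_pair_of_definition iota nubar omega' a' gamma' ->
     conjugates iota a a' ->
     gamma = gamma' /\ same_small_values iota nubar a a').
Proof.
split; last first.
  by move=> same a gamma a' gamma'; apply: same_restriction_small_values.
split=> [same|[a [gamma [a' [gamma' [mp mp' cj e small]]]]]]; last first.
  rewrite -e in mp'; have [p [_ irr pa pa']] := cj.
  apply: same_poly_restriction.
  exact: (same_omega _ _ _ mp mp' irr pa pa' small).
have [a [gamma mp]] := exists_minimal_pair iota omega_vt.
have [a' [gamma' mp']] := exists_minimal_pair iota omega'_vt.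
have same' : same_restriction_to_Kx iota omega' omega by move=> f /same.
have [p [pm irr pa]] := exists_min_poly (Kbar_algebraic a).
have [q [_ irrq qa']] := exists_min_poly (Kbar_algebraic a').
(* The two minimal pairs were chosen independently; a is replaced by a conjugate c suited to
   [omega'], and a' by a conjugate d suited to [omega]. *)
have [c pc pdc] : exists2 c, root (map_poly iota p) c &
    pair_of_definition nubar omega' c gamma'.
  by apply: conjugate_pair same mp.1 _ irr pa => //; exists a'; apply: mp'.1.
have [d qd pdd] : exists2 d, root (map_poly iota q) d &
    pair_of_definition nubar omega d gamma.
  by apply: conjugate_pair same' mp'.1 _ irrq qa' => //; exists a; apply: mp.1.
have ca : adjoin_degree iota c = adjoin_degree iota a.
  by rewrite !(adjoin_degree_irred irr).
have da' : adjoin_degree iota d = adjoin_degree iota a'.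
  by rewrite !(adjoin_degree_irred irrq).
have mpc : minimal_pair_of_definition iota nubar omega' c gamma'.
  apply: (minimal_pair_of_deg_leq omega'_vt mp' pdc).
  (* Minimality of a against d gives deg c = deg a <= deg d = deg a', so c inherits the minimality
     of a'. *)
  by rewrite ca -da'; apply: minimal_pair_deg_leq omega_vt mp _ pdd.
have cj : conjugates iota a c by exists p.
have [e small] :=
  same_restriction_small_values Kbar_algebraic omega_vt omega'_vt same mp mpc cj.
by exists a, gamma, c, gamma'.
Qed.
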